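(* There is a faithful representation of the infinite dihedral group $\mathcal{D}_\infty\cong\langle s,t\mid s^2=t^2=1\rangle$ by Riordan arrays with complex coefficients; that is, there exists an injective group homomorphism $\mathcal{D}_\infty\to\mathcal{R}(\mathbb{C})$.
   Context: Riordan group: for a field $\mathbb{K}$, $\mathcal{R}(\mathbb{K})$ is the set of pairs $(g(t),f(t))$ (Riordan arrays) of formal power series in $\mathbb{K}[[t]]$ with $g(0)\neq 0$, $f(0)=0$ and $f'(0)\neq 0$, with group operation $(g_1(t),f_1(t))*(g_2(t),f_2(t))=(g_1(t)\,g_2(f_1(t)),\,f_2(f_1(t)))$ and identity $(1,t)$. The pair $(g,f)$ is identified with the infinite lower triangular matrix with entries $a_{n,k}=[t^n]\,g(t)f(t)^k$, $n,k\geq 0$, and the operation corresponds to matrix multiplication. *)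

(* Defs.v *)
From HB Require Import structures.
From mathcomp Require Import all_boot all_order all_algebra.
From mathcomp Require Import generic_quotient boolp reals complex.

Set Implicit Arguments.
Unset Strict Implicit.
Unset Printing Implicit Defensive.

Import GRing.Theory.
Local Open Scope quotient_scope.
Local Open Scope ring_scope.

(* Formal power series K[[t]]: [f n] is the coefficient of t^n in f. *)
Record fps (K : Type) := FPS { coef_fps :> nat -> K }.

HB.instance Definition _ (K : Type) := gen_eqMixin (fps K).
HB.instance Definition _ (K : Type) := gen_choiceMixin (fps K).

Lemma fpsP (K : Type) (f g : fps K) : (forall n, f n = g n) -> f = g.
Proof. by case: f g => [f] [g] /= /funext ->. Qed.

Section FpsRing.
Variable K : comNzRingType.
Implicit Types f g h : fps K.

Definition fps_zero : fps K := FPS (fun=> 0).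
Definition fps_one : fps K := FPS (fun n => (n == 0)%:R).
Definition fps_opp f : fps K := FPS (fun n => - f n).
Definition fps_add f g : fps K := FPS (fun n => f n + g n).
Definition fps_mul f g : fps K := FPS (fun n => \sum_(i < n.+1) f i * g (n - i)%N).

Fact fps_addA : associative fps_add.
Proof. by move=> f g h; apply: fpsP => n /=; rewrite addrA. Qed.
Fact fps_addC : commutative fps_add.
Proof. by move=> f g; apply: fpsP => n /=; rewrite addrC. Qed.
Fact fps_add0 : left_id fps_zero fps_add.
Proof. by move=> f; apply: fpsP => n /=; rewrite add0r. Qed.
Fact fps_addN : left_inverse fps_zero fps_opp fps_add.
Proof. by move=> f; apply: fpsP => n /=; rewrite addNr. Qed.

HB.instance Definition _ :=
  GRing.isZmodule.Build (fps K) fps_addA fps_addC fps_add0 fps_addN.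

Let tr n f : {poly K} := \poly_(i < n.+1) f i.

Let tr_coef n f i : (i <= n)%N -> (tr n f)`_i = f i.
Proof. by move=> le_in; rewrite coef_poly ltnS le_in. Qed.

Let tr_mul n f g i : (i <= n)%N -> fps_mul f g i = (tr n f * tr n g)`_i.
Proof.
move=> le_in; rewrite coefM; apply: eq_bigr => j _.
rewrite !tr_coef //; first exact: leq_trans (leq_subr _ _) le_in.
by apply: leq_trans le_in; rewrite -ltnS.
Qed.

Fact fps_mulA : associative fps_mul.
Proof.
move=> f g h; apply: fpsP => n.
transitivity ((tr n f * (tr n g * tr n h))`_n).
  rewrite coefM; apply: eq_bigr => i _.
  by rewrite -tr_mul ?leq_subr // tr_coef // -ltnS.
rewrite mulrA coefM; apply: eq_bigr => i _.
by rewrite -tr_mul ?(tr_coef _ (leq_subr _ _)) // -ltnS.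
Qed.
Fact fps_mulC : commutative fps_mul.
Proof.
by move=> f g; apply: fpsP => n; rewrite !(tr_mul _ _ (leqnn n)) mulrC.
Qed.
Fact fps_mul1 : left_id fps_one fps_mul.
Proof.
move=> f; apply: fpsP => n /=; rewrite big_ord_recl /= mul1r subn0 big1 ?addr0 //.
by move=> i _; rewrite mul0r.
Qed.
Fact fps_mulD : left_distributive fps_mul fps_add.
Proof.
move=> f g h; apply: fpsP => n /=; rewrite -big_split /=.
by apply: eq_bigr => i _; rewrite mulrDl.
Qed.
Fact fps_one_neq0 : fps_one != fps_zero.
Proof.
by apply/eqP => /(congr1 (fun f : fps K => f 0)) /= /eqP; rewrite oner_eq0.
Qed.

HB.instance Definition _ := GRing.Zmodule_isComNzRing.Build (fps K)
  fps_mulA fps_mulC fps_mul1 fps_mulD fps_one_neq0.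

Definition fpsX : fps K := FPS (fun n => (n == 1)%:R).

(* The composite g(f(t)), meaningful when f(0) = 0: then f^k only has terms   *)
(* of degree at least k, so the coefficient of t^n in \sum_k g_k f^k is a     *)
(* sum over k <= n.                                                           *)
Definition fps_comp g f : fps K := FPS (fun n => \sum_(k < n.+1) g k * (f ^+ k) n).

Lemma fps_mulE f g n : (f * g) n = \sum_(i < n.+1) f i * g (n - i)%N.
Proof. by []. Qed.
Lemma fps_oneE n : (1 : fps K) n = (n == 0)%:R.
Proof. by []. Qed.
Lemma fps_mul0E f g : (f * g) 0 = f 0 * g 0.
Proof. by rewrite fps_mulE big_ord_recl big_ord0 addr0. Qed.

Lemma fps_exp_low f k n : f 0 = 0 -> (n < k)%N -> (f ^+ k) n = 0.
Proof.
move=> f0; elim: k n => // k IHk n lt_nk.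
rewrite exprS fps_mulE big_ord_recl f0 mul0r add0r big1 // => i _.
rewrite IHk ?mulr0 //= /bump /=.
by case: n i lt_nk => [[]//|n] i lt_nk; rewrite subSS; apply: leq_ltn_trans (leq_subr _ _) _.
Qed.

Lemma fps_exp_diag f k : f 0 = 0 -> (f ^+ k) k = f 1%N ^+ k.
Proof.
move=> f0; elim: k => // k IHk.
rewrite exprS fps_mulE 2!big_ord_recl f0 mul0r add0r /= subSS subn0 IHk -exprS.
rewrite big1 ?addr0 // => i _; rewrite fps_exp_low ?mulr0 //= /bump /= subSS.
by case: k i {IHk} => [[]//|k] i; rewrite subSS ltnS leq_subr.
Qed.

Lemma fps_comp_wide g f n N : f 0 = 0 -> (n < N)%N ->
  fps_comp g f n = \sum_(k < N) g k * (f ^+ k) n.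
Proof.
move=> f0 lt_nN; rewrite /fps_comp /=.
rewrite (big_ord_widen _ (fun k => g k * (f ^+ k) n) lt_nN) big_mkcond.
apply: eq_bigr => k _; case: ltnP => // lt_nk.
by rewrite fps_exp_low ?mulr0.
Qed.

Lemma fps_comp0 g f : fps_comp g f 0 = g 0.
Proof. by rewrite /fps_comp /= big_ord_recl big_ord0 addr0 mulr1. Qed.

Lemma fps_comp1 g f : f 0 = 0 -> fps_comp g f 1%N = g 1%N * f 1%N.
Proof.
move=> f0; rewrite /fps_comp /= !big_ord_recl big_ord0 addr0 /=.
by rewrite mulr0 add0r expr1.
Qed.

Lemma fps_comp_one f : fps_comp 1 f = 1.
Proof.
apply: fpsP => n; rewrite /fps_comp /= big_ord_recl mul1r big1 ?addr0 // => i _.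
by rewrite mul0r.
Qed.

Lemma fps_compXl f : f 0 = 0 -> fps_comp fpsX f = f.
Proof.
move=> f0; apply: fpsP => n; rewrite (@fps_comp_wide _ _ _ n.+2) //.
rewrite !big_ord_recl mul0r add0r mul1r expr1 big1 ?addr0 // => i _.
by rewrite mul0r.
Qed.

Lemma fpsX_exp k n : (fpsX ^+ k) n = (n == k)%:R.
Proof.
elim: k n => // k IHk [|n]; rewrite exprS fps_mulE big_ord_recl mul0r add0r.
  by rewrite big_ord0.
rewrite big_ord_recl mul1r /= subSS subn0 IHk eqSS big1 ?addr0 // => i _.
by rewrite mul0r.
Qed.

Lemma fps_compXr g : fps_comp g fpsX = g.
Proof.
apply: fpsP => n; rewrite /fps_comp /= big_ord_recr /= fpsX_exp eqxx mulr1.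
rewrite big1 ?add0r // => i _.
by rewrite fpsX_exp gtn_eqF ?ltn_ord ?mulr0.
Qed.

Lemma fps_comp_mul g h f : f 0 = 0 ->
  fps_comp (g * h) f = fps_comp g f * fps_comp h f.
Proof.
move=> f0; apply: fpsP => n.
pose F a b := g a * h b * (f ^+ (a + b)) n.
transitivity (\sum_(a < n.+1) \sum_(b < n.+1) F a b).
  transitivity (\sum_(k < n.+1) \sum_(a < n.+1 | (a <= k)%N) F a (k - a)%N).
    apply: eq_bigr => k _; rewrite fps_mulE mulr_suml.
    rewrite (big_ord_widen _ (fun a => g a * h (k - a)%N * (f ^+ k) n) (ltn_ord k)).
    by apply: eq_bigr => a le_ak; rewrite /F subnKC.
  rewrite (exchange_big_dep xpredT) //=; apply: eq_bigr => a _.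
  rewrite -(big_mkord (fun k => (a <= k)%N) (fun k => F a (k - a)%N)).
  rewrite (big_cat_nat (n := a)) //=; last exact: ltnW.
  rewrite big_nat_cond big1 ?add0r; last first.
    by move=> k /andP[/andP[_ lt_ka] /(leq_trans lt_ka)]; rewrite ltnn.
  rewrite big_nat_cond (eq_bigl (fun k => (a <= k < n.+1)%N && true)); last first.
    by move=> k /=; case: (a <= k)%N; rewrite ?andbT ?andbF.
  rewrite -big_nat_cond -{1}[a : nat]add0n big_addn.
  rewrite -(big_mkord xpredT (fun b => F a b)) [RHS](big_cat_nat (n := (n.+1 - a)%N)) ?leq_subr //=.
  rewrite [X in _ = _ + X]big_nat_cond [X in _ = _ + X]big1 ?addr0; last first.
    move=> b /andP[/andP[le_b _] _]; rewrite /F fps_exp_low ?mulr0 //.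
    by rewrite -leq_subLR.
  by apply: eq_bigr => b _; rewrite addnK.
rewrite fps_mulE.
transitivity (\sum_(i < n.+1) \sum_(a < n.+1) \sum_(b < n.+1)
   (g a * (f ^+ a) i) * (h b * (f ^+ b) (n - i)%N)).
  rewrite [RHS]exchange_big; apply: eq_bigr => a _.
  rewrite [RHS]exchange_big; apply: eq_bigr => b _.
  rewrite /F exprD fps_mulE mulr_sumr; apply: eq_bigr => i _.
  by rewrite mulrACA.
apply: eq_bigr => i _; rewrite !(@fps_comp_wide _ _ _ n.+1) ?ltn_ord ?ltnS ?leq_subr //.
by rewrite mulr_suml; apply: eq_bigr => a _; rewrite mulr_sumr.
Qed.

Lemma fps_comp_exp g f k : f 0 = 0 -> fps_comp (g ^+ k) f = fps_comp g f ^+ k.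
Proof.
move=> f0; elim: k => [|k IHk]; first by rewrite !expr0 fps_comp_one.
by rewrite !exprS fps_comp_mul // IHk.
Qed.

Lemma fps_compA g f h : f 0 = 0 -> h 0 = 0 ->
  fps_comp (fps_comp g f) h = fps_comp g (fps_comp f h).
Proof.
move=> f0 h0; apply: fpsP => n.
transitivity (\sum_(k < n.+1) \sum_(j < n.+1) g j * ((f ^+ j) k * (h ^+ k) n)).
  apply: eq_bigr => k _; rewrite (@fps_comp_wide _ _ _ n.+1) // mulr_suml.
  by apply: eq_bigr => j _; rewrite mulrA.
rewrite exchange_big; apply: eq_bigr => j _.
by rewrite -fps_comp_exp // -mulr_sumr.
Qed.

End FpsRing.

(* Forward substitution: the solution x of \sum_(k <= n) M n k * x k = u n.  *)
Section TriangularSolve.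
Variables (K : fieldType) (M : nat -> nat -> K) (u : nat -> K).

Fixpoint tri_prefix n : seq K :=
  if n is m.+1 then
    let s := tri_prefix m in
    rcons s ((u m - \sum_(k < m) M m k * s`_k) / M m m)
  else [::].

Definition tri_solve n : K := (tri_prefix n.+1)`_n.

Let size_tri n : size (tri_prefix n) = n.
Proof. by elim: n => //= n IHn; rewrite size_rcons IHn. Qed.

Let nth_tri n k : (k < n)%N -> (tri_prefix n)`_k = tri_solve k.
Proof.
elim: n => // n IHn; rewrite ltnS leq_eqVlt => /predU1P[->//|lt_kn].
by rewrite /= nth_rcons size_tri lt_kn IHn.
Qed.

Lemma tri_solveP n : M n n != 0 ->
  \sum_(k < n.+1) M n k * tri_solve k = u n.
Proof.
move=> Mn0; rewrite big_ord_recr /= {2}/tri_solve /= nth_rcons size_tri ltnn eqxx.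
rewrite mulrC divfK // (eq_bigr (fun k : 'I_n => M n k * (tri_prefix n)`_k)).
  by rewrite addrC subrK.
by move=> k _; rewrite nth_tri.
Qed.

End TriangularSolve.

Section FpsField.
Variable K : fieldType.
Implicit Types f g u : fps K.

Definition fps_recip g : fps K :=
  FPS (tri_solve (fun n k => g (n - k)%N) (1 : fps K)).

Lemma fps_mulVr g : g 0 != 0 -> g * fps_recip g = 1.
Proof.
move=> g0; rewrite mulrC; apply: fpsP => n.
rewrite -[RHS](@tri_solveP _ (fun n k => g (n - k)%N)) ?subnn //.
by apply: eq_bigr => k _; rewrite mulrC.
Qed.

(* The series h with h(f(t)) = u. *)
Definition fps_comp_solve f u : fps K :=
  FPS (tri_solve (fun n k => (f ^+ k) n) u).

Lemma fps_comp_solveP f u : f 0 = 0 -> f 1%N != 0 ->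
  fps_comp (fps_comp_solve f u) f = u.
Proof.
move=> f0 f1; apply: fpsP => n.
rewrite -[RHS](@tri_solveP _ (fun n k => (f ^+ k) n)); last first.
  by rewrite fps_exp_diag // expf_neq0.
by apply: eq_bigr => k _; rewrite mulrC.
Qed.

End FpsField.

(* The Riordan group R(K). The value f'(0) is the coefficient of t in f.     *)
Record riordan (K : fieldType) := Riordan {
  rg : fps K;
  rf : fps K;
  riordanP : [&& rg 0 != 0, rf 0 == 0 & rf 1%N != 0] }.

HB.instance Definition _ (K : fieldType) := gen_eqMixin (riordan K).
HB.instance Definition _ (K : fieldType) := gen_choiceMixin (riordan K).

Section RiordanGroup.
Variable K : fieldType.
Implicit Types x y z : riordan K.

Lemma riordan_eq x y : rg x = rg y -> rf x = rf y -> x = y.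
Proof.
case: x y => [g f p] [g' f' p'] /= eg ef; rewrite -{}eg -{}ef in p' *.
by rewrite (bool_irrelevance p p').
Qed.

Lemma rg0 x : rg x 0 != 0. Proof. by case/and3P: (riordanP x). Qed.
Lemma rf0 x : rf x 0 = 0. Proof. by case/and3P: (riordanP x) => _ /eqP. Qed.
Lemma rf1 x : rf x 1%N != 0. Proof. by case/and3P: (riordanP x). Qed.

Fact riordan_one_proof :
  [&& (1 : fps K) 0 != 0, fpsX K 0 == 0 & fpsX K 1%N != 0].
Proof. by rewrite /= eqxx oner_neq0. Qed.
Definition riordan_one : riordan K := Riordan riordan_one_proof.

Fact riordan_mul_proof x y :
  [&& (rg x * fps_comp (rg y) (rf x)) 0 != 0, fps_comp (rf y) (rf x) 0 == 0
    & fps_comp (rf y) (rf x) 1%N != 0].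
Proof.
rewrite fps_mul0E !fps_comp0 fps_comp1 ?rf0 // eqxx !mulf_neq0 //.
all: by rewrite ?rg0 ?rf1.
Qed.
Definition riordan_mul x y : riordan K := Riordan (riordan_mul_proof x y).

Fact riordan_inv_proof x :
  [&& fps_comp_solve (rf x) (fps_recip (rg x)) 0 != 0,
      fps_comp_solve (rf x) (fpsX K) 0 == 0
    & fps_comp_solve (rf x) (fpsX K) 1%N != 0].
Proof.
have solve u := fps_comp_solveP u (rf0 x) (rf1 x).
have solve0 u : fps_comp_solve (rf x) u 0 = u 0.
  by rewrite -(fps_comp0 _ (rf x)) solve.
rewrite !solve0; apply/and3P; split=> //; apply/eqP => h0.
  have := congr1 (fun f : fps K => f 0) (fps_mulVr (rg0 x)).
  by rewrite fps_mul0E h0 mulr0 => /eqP; rewrite eq_sym oner_eq0.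
have := congr1 (fun f : fps K => f 1%N) (solve (fpsX K)).
by rewrite fps_comp1 ?rf0 // h0 mul0r => /eqP; rewrite eq_sym oner_eq0.
Qed.
Definition riordan_inv x : riordan K := Riordan (riordan_inv_proof x).

Fact riordan_mulA : associative riordan_mul.
Proof.
move=> x y z; apply: riordan_eq => /=; last by rewrite fps_compA ?rf0.
by rewrite fps_comp_mul ?rf0 // fps_compA ?rf0 // mulrA.
Qed.
Fact riordan_mul1x : left_id riordan_one riordan_mul.
Proof. by move=> x; apply: riordan_eq; rewrite /= fps_compXr ?mul1r. Qed.
Fact riordan_mulx1 : right_id riordan_one riordan_mul.
Proof.
by move=> x; apply: riordan_eq; rewrite /= ?fps_comp_one ?mulr1 ?fps_compXl ?rf0.
Qed.
Fact riordan_mulxV : right_inverse riordan_one riordan_inv riordan_mul.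
Proof.
move=> x; apply: riordan_eq; rewrite /= fps_comp_solveP ?rf0 ?rf1 //.
exact/fps_mulVr/rg0.
Qed.
Fact riordan_mulVx : left_inverse riordan_one riordan_inv riordan_mul.
Proof.
move=> x; set y := riordan_inv x; rewrite -[LHS]riordan_mulx1.
rewrite -[X in riordan_mul _ X = _](riordan_mulxV y) -riordan_mulA.
by rewrite [X in riordan_mul y X]riordan_mulA riordan_mulxV riordan_mul1x riordan_mulxV.
Qed.

HB.instance Definition _ := isGroup.Build (riordan K)
  riordan_mulA riordan_mul1x riordan_mulx1 riordan_mulVx riordan_mulxV.

Lemma rgM x y : rg (x * y)%g = rg x * fps_comp (rg y) (rf x).
Proof. by []. Qed.
Lemma rfM x y : rf (x * y)%g = fps_comp (rf y) (rf x).
Proof. by []. Qed.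
Lemma rg1 : rg (1%g : riordan K) = 1. Proof. by []. Qed.
Lemma rfX : rf (1%g : riordan K) = fpsX K. Proof. by []. Qed.

Definition riordan_entry x n k : K := (rg x * rf x ^+ k) n.

(* Each row is supported on k <= n, so the product of the two infinite        *)
(* matrices is computed by finite sums.                                       *)
Lemma riordan_entry_low x n k : (n < k)%N -> riordan_entry x n k = 0.
Proof.
move=> lt_nk; rewrite /riordan_entry fps_mulE big1 // => i _.
rewrite fps_exp_low ?mulr0 ?rf0 //.
exact: leq_ltn_trans (leq_subr _ _) lt_nk.
Qed.

Lemma riordan_entryM x y n k :
  riordan_entry (x * y)%g n k =
  \sum_(j < n.+1) riordan_entry x n j * riordan_entry y j k.
Proof.
rewrite [LHS]/riordan_entry rgM rfM -fps_comp_exp ?rf0 // -mulrA -fps_comp_mul ?rf0 //.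
under eq_bigr => j _ do rewrite /riordan_entry fps_mulE mulr_suml.
rewrite exchange_big fps_mulE; apply: eq_bigr => i _.
rewrite (@fps_comp_wide _ _ _ _ n.+1) ?rf0 ?ltnS ?leq_subr // mulr_sumr.
by apply: eq_bigr => j _; rewrite -mulrA [X in _ = _ * X]mulrC.
Qed.

Lemma riordan_entry_inj x y :
  (forall n k, riordan_entry x n k = riordan_entry y n k) -> x = y.
Proof.
move=> exy; have eg : rg x = rg y.
  by apply: fpsP => n; have := exy n 0; rewrite /riordan_entry !expr0 !mulr1.
apply: riordan_eq => //.
have egf : rg x * rf x = rg x * rf y.
  by apply: fpsP => n; have := exy n 1%N; rewrite /riordan_entry -eg !expr1.
rewrite -[LHS]mul1r -[RHS]mul1r -(fps_mulVr (rg0 x)) mulrAC egf.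
by rewrite mulrAC.
Qed.

End RiordanGroup.

(* The group < T | rels > presented by generators T and relators rels.       *)
(* Words are sequences of letters; (x, true) is x and (x, false) is x^-1.    *)
Section Presentation.
Variables (T : choiceType) (rels : seq (seq (T * bool))).
Local Notation word := (seq (T * bool)).
Implicit Types u v w r : word.

Inductive pres_eq : word -> word -> Prop :=
| PresRefl w : pres_eq w w
| PresSym u v : pres_eq u v -> pres_eq v u
| PresTrans u v w : pres_eq u v -> pres_eq v w -> pres_eq u w
| PresCancel u v x b : pres_eq (u ++ [:: (x, b); (x, ~~ b)] ++ v) (u ++ v)
| PresRel u v r : r \in rels -> pres_eq (u ++ r ++ v) (u ++ v).

Definition pres_rel : rel word := fun u v => `[< pres_eq u v >].

Fact pres_rel_refl : reflexive pres_rel.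
Proof. by move=> w; apply/asboolP/PresRefl. Qed.
Fact pres_rel_sym : symmetric pres_rel.
Proof. by move=> u v; apply/asboolP/asboolP; apply: PresSym. Qed.
Fact pres_rel_trans : transitive pres_rel.
Proof. by move=> v u w /asboolP uv /asboolP vw; apply/asboolP/(PresTrans uv). Qed.

Canonical pres_equiv : equiv_rel word :=
  EquivRel pres_rel pres_rel_refl pres_rel_sym pres_rel_trans.

Definition presented := {eq_quot pres_equiv}.
HB.instance Definition _ := Choice.on presented.

Definition pres_class w : presented := \pi_{eq_quot pres_equiv} w.
Definition pres_repr (a : presented) : word := repr a.

Lemma pres_reprK a : pres_class (pres_repr a) = a.
Proof. exact: reprK. Qed.

Lemma pres_classP u v : pres_class u = pres_class v <-> pres_eq u v.
Proof.
split=> [/eqP|uv]; first by rewrite eqmodE => /asboolP.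
by apply/eqP; rewrite eqmodE; apply/asboolP.
Qed.

Lemma pres_eq_cat u u' v v' :
  pres_eq u u' -> pres_eq v v' -> pres_eq (u ++ v) (u' ++ v').
Proof.
move=> uu' vv'; apply: (@PresTrans _ (u' ++ v)).
  elim: uu' => {u u'} [w|u u' _|u u' w _ uu' _|u u' x b|u u' r].
  - exact: PresRefl.
  - exact: PresSym.
  - exact: PresTrans.
  - by rewrite -!catA; apply: PresCancel.
  - by rewrite -!catA; apply: PresRel.
elim: vv' => {v v'} [w|v v' _|v v' w _ vv' _|v v' x b|v v' r].
- exact: PresRefl.
- exact: PresSym.
- exact: PresTrans.
- by rewrite !(catA u'); apply: PresCancel.
- by move=> rr; rewrite !(catA u'); apply: PresRel.
Qed.

Definition word_inv w : word := rev [seq (l.1, ~~ l.2) | l <- w].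

Lemma word_mulV w : pres_eq (w ++ word_inv w) [::].
Proof.
elim: w => [|[x b] w IHw]; first exact: PresRefl.
rewrite /word_inv /= rev_cons -cats1 catA.
apply: PresTrans (PresCancel [::] [::] x b).
exact: (pres_eq_cat (PresRefl [:: (x, b)]) (pres_eq_cat IHw (PresRefl [:: (x, ~~ b)]))).
Qed.

Lemma word_invK : involutive word_inv.
Proof.
move=> w; rewrite /word_inv map_rev revK -map_comp -[RHS]map_id.
by apply: eq_map => -[x b] /=; rewrite negbK.
Qed.

Lemma word_mulVl w : pres_eq (word_inv w ++ w) [::].
Proof. by rewrite -{2}[w]word_invK; apply: word_mulV. Qed.

Definition pres_one : presented := pres_class [::].
Definition pres_mul (a b : presented) := pres_class (pres_repr a ++ pres_repr b).
Definition pres_inv (a : presented) := pres_class (word_inv (pres_repr a)).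

Lemma pres_class_mul u v :
  pres_mul (pres_class u) (pres_class v) = pres_class (u ++ v).
Proof. by apply/pres_classP/pres_eq_cat; apply/pres_classP/pres_reprK. Qed.

Fact pres_mulA : associative pres_mul.
Proof.
move=> a b c; rewrite -[a]pres_reprK -[b]pres_reprK -[c]pres_reprK.
by rewrite !pres_class_mul catA.
Qed.
Fact pres_mul1x : left_id pres_one pres_mul.
Proof. by move=> a; rewrite -[a]pres_reprK pres_class_mul. Qed.
Fact pres_mulx1 : right_id pres_one pres_mul.
Proof. by move=> a; rewrite -[a]pres_reprK pres_class_mul cats0. Qed.
Fact pres_mulVx : left_inverse pres_one pres_inv pres_mul.
Proof.
move=> a; rewrite -{2}[a]pres_reprK pres_class_mul.
exact/pres_classP/word_mulVl.
Qed.
Fact pres_mulxV : right_inverse pres_one pres_inv pres_mul.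
Proof.
move=> a; rewrite -{1}[a]pres_reprK pres_class_mul.
exact/pres_classP/word_mulV.
Qed.

HB.instance Definition _ := isGroup.Build presented
  pres_mulA pres_mul1x pres_mulx1 pres_mulVx pres_mulxV.

Definition pres_gen (x : T) : presented := pres_class [:: (x, true)].

Lemma pres_classM u v : pres_class (u ++ v) = (pres_class u * pres_class v)%g.
Proof. by rewrite -pres_class_mul. Qed.

Section Eval.
Local Open Scope group_scope.
Variables (G : groupType) (gen : T -> G).

Definition word_eval w : G :=
  foldr (fun l a => (if l.2 then gen l.1 else (gen l.1)^-1) * a) 1 w.

Lemma word_eval_cat u v : word_eval (u ++ v) = word_eval u * word_eval v.
Proof. by elim: u => [|l u IHu] /=; rewrite ?mul1g // IHu mulgA. Qed.

Lemma word_eval_eq : (forall r, r \in rels -> word_eval r = 1) ->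
  forall u v, pres_eq u v -> word_eval u = word_eval v.
Proof.
move=> relE u v; elim=> {u v} [//|//|u v w _ -> _ ->//|u v x b|u v r /relE rE].
  by rewrite !word_eval_cat; case: b; rewrite /= !mulg1 ?mulgV ?mulVg mul1g.
by rewrite !word_eval_cat rE mul1g.
Qed.

Lemma presented_lift : (forall r, r \in rels -> word_eval r = 1) ->
  exists2 phi : {multiplicative presented -> G},
    (forall w, phi (pres_class w) = word_eval w) &
    (forall x, phi (pres_gen x) = gen x).
Proof.
move=> /word_eval_eq evalE; pose f a := word_eval (pres_repr a).
have fE w : f (pres_class w) = word_eval w.
  by apply: evalE; apply/pres_classP/pres_reprK.
have fM : {morph f : a b / a * b} by move=> a b; rewrite fE word_eval_cat.
pose phi : {multiplicative presented -> G} :=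
  HB.pack f (isMultiplicative.Build _ _ f fM).
exists phi => //= x.
by rewrite fE /= mulg1.
Qed.

End Eval.

End Presentation.

(* < s, t | s^2 = t^2 = 1 >, with generator letters false for s, true for t. *)
Definition dihedral_infty : groupType :=
  presented [:: [:: (false, true); (false, true)];
                [:: (true, true); (true, true)]].

(* Main.v *)
Require Import Defs.
From HB Require Import structures.
From mathcomp Require Import all_boot all_order all_algebra.
From mathcomp Require Import boolp reals complex.

(* Every Riordan array (g, -t) with g(t) g(-t) = 1 is an involution. Pick such a g with g = 1 + 2t + ...
   and send t to (g(t), -t) and s to (g(-t), -t). Every element of the dihedral group is an
   alternating word in s and t, and an alternating word of length n is sent to an array whose first
   component has linear coefficient 2n or -2n, so only the empty word is sent to the identity. *)

Import GRing.Theory Num.Theory.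

Local Open Scope ring_scope.
Local Open Scope complex_scope.

Section Reflection.
Variable K : fieldType.
Implicit Types f g v : fps K.

Definition fps_reflect f : fps K := fps_comp f (- fpsX K).

Lemma oppX0 : (- fpsX K) 0%N = 0.
Proof. exact: oppr0. Qed.

Lemma fps_reflectX : fps_reflect (- fpsX K) = fpsX K.
Proof.
(* Widening the sum to k < n + 2 makes the k = 1 term present even for n = 0. *)
apply: fpsP => n; rewrite /fps_reflect (@fps_comp_wide _ _ _ n n.+2) ?oppX0 //.
rewrite !big_ord_recl oppX0 mul0r add0r big1 ?addr0 => [|i _].
  by rewrite expr1 /= mulN1r opprK.
by rewrite [(- fpsX K) _]oppr0 mul0r.
Qed.

Lemma fps_reflectK f : fps_reflect (fps_reflect f) = f.
Proof.
rewrite {1}/fps_reflect fps_compA ?oppX0 // -/(fps_reflect _) fps_reflectX.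
exact: fps_compXr.
Qed.

Lemma fps_reflectM f g : fps_reflect (f * g) = fps_reflect f * fps_reflect g.
Proof. by rewrite /fps_reflect fps_comp_mul ?oppX0. Qed.

Lemma fps_reflect_coef0 f : fps_reflect f 0%N = f 0%N.
Proof. exact: fps_comp0. Qed.

Lemma fps_reflect_coef1 f : fps_reflect f 1%N = - f 1%N.
Proof. by rewrite /fps_reflect fps_comp1 ?oppX0 //= mulrN1. Qed.

Lemma fps_mul_coef1 f g : (f * g) 1%N = f 0%N * g 1%N + f 1%N * g 0%N.
Proof. by rewrite fps_mulE !big_ord_recl big_ord0 addr0. Qed.

(* The witness is v(t) / v(-t), where v = 1 + t + t^2 + ... *)
Lemma exists_reflect_inverse :
  exists g, [/\ g * fps_reflect g = 1, g 0%N = 1 & g 1%N = 2%:R].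
Proof.
pose v : fps K := FPS (fun=> 1); pose w := fps_reflect v.
have w0 : w 0%N = 1 by rewrite fps_reflect_coef0.
have w1 : w 1%N = - 1 by rewrite fps_reflect_coef1.
have wV : w * fps_recip w = 1 by rewrite fps_mulVr // w0 oner_neq0.
have r0 : fps_recip w 0%N = 1.
  by have := congr1 (fun f : fps K => f 0%N) wV; rewrite fps_mul0E w0 mul1r.
have r1 : fps_recip w 1%N = 1.
  have := congr1 (fun f : fps K => f 1%N) wV.
  by rewrite fps_mul_coef1 w0 w1 r0 mul1r mulr1 => /eqP; rewrite subr_eq0 => /eqP.
exists (v * fps_recip w); split.
(* With r the reciprocal of w, the product regroups as (v(t) r(-t)) (w(t) r(t)), and v(t) r(-t) is
   the reflection of w r = 1. *)
- rewrite fps_reflectM mulrACA [fps_recip w * _]mulrC mulrACA -/w wV mulr1.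
  by rewrite -[v]fps_reflectK -fps_reflectM -/w wV; apply: fps_comp_one.
- by rewrite fps_mul0E r0 mulr1.
- by rewrite fps_mul_coef1 r0 r1 !mulr1.
Qed.

Fact reflection_proof g : g 0%N = 1 ->
  [&& g 0%N != 0, (- fpsX K) 0%N == 0 & (- fpsX K) 1%N != 0].
Proof. by move=> ->; rewrite oppX0 eqxx oner_neq0 /= oppr_eq0 oner_neq0. Qed.

Definition reflection g (g0 : g 0%N = 1) : riordan K :=
  Riordan (reflection_proof g g0).

Lemma reflection_sqr g (g0 : g 0%N = 1) :
  g * fps_reflect g = 1 -> (reflection g g0 * reflection g g0 = 1)%g.
Proof. by move=> gV; apply: riordan_eq; last exact: fps_reflectX. Qed.

End Reflection.

Section MultiplicativeGroups.
Local Open Scope group_scope.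
Variables (G H : groupType) (f : {multiplicative G -> H}).

(** A [multiplicative] map is only required to preserve products; cancellation in f(1) f(1) = f(1)
    gives the rest. *)
Lemma multiplicative1 : f 1 = 1.
Proof. by apply: (mulgI (f 1)); rewrite -gmulfM !mulg1. Qed.

Lemma multiplicative_inj : (forall x, f x = 1 -> x = 1) -> injective f.
Proof.
move=> ker x y eq_xy; apply: (mulIg y^-1).
by rewrite mulgV; apply: ker; rewrite gmulfM eq_xy -gmulfM mulgV multiplicative1.
Qed.

End MultiplicativeGroups.

Section Alternating.
Local Open Scope group_scope.
Implicit Types (b : bool) (a : dihedral_infty).

Definition dih_gen b : dihedral_infty := pres_gen _ b.

Lemma dih_gen_sqr b : dih_gen b * dih_gen b = 1.
Proof.
rewrite [LHS]pres_class_mul; apply/pres_classP.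
apply: (PresRel [::] [::] (r := [:: (b, true); (b, true)])).
by rewrite !inE; case: b; rewrite eqxx ?orbT.
Qed.

Lemma dih_gen_inv b : (dih_gen b)^-1 = dih_gen b.
Proof. by rewrite -[LHS]mulg1 -(dih_gen_sqr b) mulgA mulVg mul1g. Qed.

(** Stated over any group, so that the same word can be read in the dihedral group and in the
    Riordan group. *)
Fixpoint alternating (gT : groupType) (x : bool -> gT) b n : gT :=
  if n is m.+1 then x b * alternating gT x (~~ b) m else 1.

(** Induction on a representing word: each letter equals its inverse, and a new first letter either
    cancels the old one or extends the alternation. *)
Lemma dih_alternating a : exists b n, a = alternating _ dih_gen b n.
Proof.
rewrite -[a]pres_reprK; elim: (pres_repr a) => [|[c e] w [b [n IHw]]].
  by exists true, 0%N.
have -> : pres_class _ ((c, e) :: w) = dih_gen c * alternating _ dih_gen b n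
    :> dihedral_infty.
  rewrite -IHw [LHS](pres_classM _ [:: (c, e)] w); congr (_ * _).
  case: e => //; rewrite -dih_gen_inv; apply: (mulIg (dih_gen c)); rewrite mulVg.
  rewrite [LHS]pres_class_mul; apply/pres_classP.
  exact: (PresCancel _ [::] [::] c false).
(* For n = 0 the letter b carries no information, so c starts a new word. *)
case: n {IHw} => [|n]; first by exists c, 1%N.
have [->|/negPf neq_cb] := eqVneq c b.
  by exists (~~ b), n; rewrite /= mulgA dih_gen_sqr mul1g.
by exists c, n.+2; rewrite /=; case: c b neq_cb => [] [].
Qed.

End Alternating.

Lemma riordan_reflections_faithful (K : numFieldType) :
  exists phi : {multiplicative dihedral_infty -> riordan K}, injective phi.
Proof.
have [g [gV g0 g1]] := exists_reflect_inverse K.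
have h0 : fps_reflect K g 0%N = 1 by rewrite fps_reflect_coef0.
(* The sign is + for [true], the array of g(t), and - for [false], the array of g(-t). *)
have [x [xx rfx rgx0 rgx1]] : exists x : bool -> riordan K,
    [/\ forall b, (x b * x b = 1)%g, forall b, rf (x b) = - fpsX K,
        forall b, rg (x b) 0%N = 1
      & forall b, rg (x b) 1%N = (-1) ^+ (~~ b) * 2%:R].
  exists (fun b => if b then reflection K g g0 else reflection K _ h0).
  split=> -[] //.
  - exact: reflection_sqr.
  - by apply: reflection_sqr; rewrite fps_reflectK mulrC.
  - by rewrite mul1r.
  - by rewrite mulN1r -g1; apply: fps_reflect_coef1.
have [phi phi_gen] : exists phi : {multiplicative dihedral_infty -> riordan K},
    forall b, phi (dih_gen b) = x b.
  have [|phi _ phi_gen] := @presented_lift _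
      [:: [:: (false, true); (false, true)]; [:: (true, true); (true, true)]] _ x.
    by move=> r; rewrite !inE => /orP[] /eqP-> /=; rewrite mulg1 xx.
  by exists phi.
have phi_alt b n : phi (alternating _ dih_gen b n) = alternating _ x b n.
  elim: n b => [|n IHn] b; first exact: multiplicative1.
  by rewrite [LHS]gmulfM IHn phi_gen.
(* Prepending a letter to a word with first component a(t) gives a first component with factor
   a(-t). This negates the linear coefficient of a, whose sign was opposite to that of the new
   letter, so the absolute values add. *)
have alt_coef b n : rg (alternating _ x b n) 0%N = 1 /\
    rg (alternating _ x b n) 1%N = (-1) ^+ (~~ b) * (n * 2)%:R.
  elim: n b => [|n IHn] b; first by rewrite /= mul0n mulr0.
  have [a0 a1] := IHn (~~ b).
  have -> : alternating _ x b n.+1 = (x b * alternating _ x (~~ b) n)%g by [].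
  rewrite rgM rfx -/(fps_reflect K _) fps_mul0E fps_mul_coef1.
  rewrite fps_reflect_coef0 fps_reflect_coef1 rgx0 rgx1 a0 a1 !mul1r !mulr1.
  split=> //; rewrite mulSn natrD [RHS]mulrDr addrC; congr (_ + _).
  by rewrite -mulNr; case: b {IHn a0 a1}; rewrite /= ?opprK.
exists phi; apply: multiplicative_inj => a.
have [b [n ->]] := dih_alternating a; rewrite phi_alt => alt1.
have [_] := alt_coef b n; rewrite alt1 => /esym/eqP.
(* The identity array has linear coefficient 0, and in characteristic zero 2n = 0 forces n = 0. *)
by rewrite mulf_eq0 signr_eq0 pnatr_eq0 muln_eq0 orbF => /eqP->.
Qed.

Theorem corollary2 (R : realType) :
  exists phi : {multiplicative dihedral_infty -> riordan R[i]}, injective phi.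
Proof. exact: riordan_reflections_faithful. Qed.
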